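(* Let $S$ be a $\Gamma$-semiring which has a left unity and a right unity, and let $R$ be its right operator semiring. For a fuzzy subset $\sigma$ of $S$ let $\sigma^{*'}$ be the fuzzy subset of $R$ defined by $\sigma^{*'}(\sum_i[\alpha_i,x_i])=\inf_{a\in S}\sigma(\sum_i a\alpha_i x_i)$ for $\sum_i[\alpha_i,x_i]\in R$. Then: (1) if $\sigma$ is a fuzzy left (respectively right) ideal of $S$, then $\sigma^{*'}$ is a fuzzy left (respectively right) ideal of $R$; (2) if $\sigma$ is a fuzzy ideal of $S$, then $\sigma^{*'}$ is a fuzzy ideal of $R$.
   Context: $\Gamma$-semiring: $S$ and $\Gamma$ are (nonempty) additive commutative semigroups with a map $S\times\Gamma\times S\to S$, $(a,\alpha,b)\mapsto a\alpha b$, such that $a\alpha(b+c)=a\alpha b+a\alpha c$, $(a+b)\alpha c=a\alpha c+b\alpha c$, $a(\alpha+\beta)c=a\alpha c+a\beta c$, $a\alpha(b\beta c)=(a\alpha b)\beta c$ for all $a,b,c\in S$, $\alpha,\beta\in\Gamma$. No zero elements are assumed. Right operator semiring $R$: let $G$ be the free additive commutative semigroup generated by $\Gamma\times S$ (finite nonempty formal sums). Identify $\sum_i(\alpha_i,x_i)$ with $\sum_j(\beta_j,y_j)$ iff $\sum_i a\alpha_i x_i=\sum_j a\beta_j y_j$ for all $a\in S$; this is a congruence on $G$. The class of $\sum_i(\alpha_i,x_i)$ is written $\sum_i[\alpha_i,x_i]$. $R$ is the quotient, with the induced addition and the multiplication $(\sum_i[\alpha_i,x_i])(\sum_j[\beta_j,y_j])=\sum_{i,j}[\alpha_i,x_i\beta_j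 y_j]$; it is a semiring. Unities: a right unity of $S$ is a finite sum $\sum_j[\gamma_j,f_j]\in R$ with $\sum_j a\gamma_j f_j=a$ for all $a\in S$. A left unity of $S$ is given by finitely many $e_i\in S$, $\delta_i\in\Gamma$ with $\sum_i e_i\delta_i a=a$ for all $a\in S$. A fuzzy subset of a set $X$ is a function $X\to[0,1]$. A fuzzy subset $\mu$ of $S$ is a fuzzy left (respectively right) ideal of $S$ if for all $a,b\in S$, $\alpha\in\Gamma$: $\mu(a+b)\ge\min(\mu(a),\mu(b))$ and $\mu(a\alpha b)\ge\mu(b)$ (respectively $\mu(a\alpha b)\ge\mu(a)$). A fuzzy subset $\mu$ of $R$ is a fuzzy left (respectively right) ideal of $R$ if for all $p,q\in R$: $\mu(p+q)\ge\min(\mu(p),\mu(q))$ and $\mu(pq)\ge\mu(q)$ (respectively $\mu(pq)\ge\mu(p)$). A fuzzy ideal (of $S$ or of $R$) is a fuzzy subset that is both a fuzzy left ideal and a fuzzy right ideal. *)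

(* Defs.v *)
From HB Require Import structures.
From mathcomp Require Import all_boot all_order all_algebra.
From mathcomp Require Import interval_inference all_classical all_reals.

Set Implicit Arguments.
Unset Strict Implicit.
Unset Printing Implicit Defensive.

Import Order.TTheory GRing.Theory Num.Theory.

Local Open Scope ring_scope.
Local Open Scope quotient_scope.

(* [addSemigroupType] is commutative and has no zero. *)

HB.mixin Record isGammaSemiring (G : addSemigroupType) S
    of Algebra.AddSemigroup S := {
  gamma_inhabited : inhabited G;
  carrier_inhabited : inhabited S;
  tmul : S -> G -> S -> S;
  tmulDr : forall a (al : G) b c, tmul a al (b + c) = tmul a al b + tmul a al c;
  tmulDl : forall a b (al : G) c, tmul (a + b) al c = tmul a al c + tmul b al c;
  tmulDm : forall a (al be : G) c,
    tmul a (al + be) c = tmul a al c + tmul a be c;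
  tmulA : forall a (al : G) b (be : G) c,
    tmul a al (tmul b be c) = tmul (tmul a al b) be c
}.

#[short(type="gammaSemiringType")]
HB.structure Definition GammaSemiring (G : addSemigroupType) :=
  {S of isGammaSemiring G S & Algebra.AddSemigroup S}.

Reserved Notation "a ·[ al ] b"
  (at level 40, al at level 200, left associativity,
   format "a  ·[ al ]  b").
Notation "a ·[ al ] b" := (tmul a al b) : ring_scope.

(* Semirings without zero or one. *)
HB.mixin Record isBareSemiring R of Algebra.AddSemigroup R & Semigroup R := {
  bmulDl : forall p q r : R, ((p + q)%R * r)%g = (p * r)%g + (q * r)%g;
  bmulDr : forall p q r : R, (p * (q + r)%R)%g = (p * q)%g + (p * r)%g
}.

#[short(type="bareSemiringType")]
HB.structure Definition BareSemiring :=
  {R of isBareSemiring R & Algebra.AddSemigroup R & Semigroup R}.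

(* The free commutative semigroup on X: nonempty words modulo permutation,    *)
(* the word (x, s) standing for x :: s.                                       *)
Section FormalSums.
Variable X : choiceType.

Definition letters (w : X * seq X) : seq X := w.1 :: w.2.

Definition word_perm (u v : X * seq X) : bool :=
  perm_eq (letters u) (letters v).

Lemma word_perm_refl : reflexive word_perm.
Proof. by move=> u; exact: perm_refl. Qed.

Lemma word_perm_sym : symmetric word_perm.
Proof. by move=> u v; exact: perm_sym. Qed.

Lemma word_perm_trans : transitive word_perm.
Proof. by move=> u v w; exact: perm_trans. Qed.

Canonical word_perm_equiv :=
  EquivRel word_perm word_perm_refl word_perm_sym word_perm_trans.

Definition formal_sum := {eq_quot word_perm}.
HB.instance Definition _ := Choice.on formal_sum.
HB.instance Definition _ := EqQuotient.on formal_sum.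

Definition fgen (x : X) : formal_sum := \pi_formal_sum (x, [::]).

Definition word_cat (u v : X * seq X) : X * seq X := (u.1, u.2 ++ letters v).

Definition fadd (g h : formal_sum) : formal_sum :=
  \pi_formal_sum (word_cat (repr g) (repr h)).

Lemma word_perm_repr (u : X * seq X) :
  word_perm (repr (\pi_formal_sum u)) u.
Proof. by apply/eqmodP; rewrite reprK. Qed.

Lemma word_permP (u v : X * seq X) :
  word_perm u v -> \pi_formal_sum u = \pi_formal_sum v.
Proof. by move=> uv; apply/eqmodP. Qed.

Lemma faddE (u v : X * seq X) :
  fadd (\pi_formal_sum u) (\pi_formal_sum v) = \pi_formal_sum (word_cat u v).
Proof.
apply: word_permP.
exact: (perm_cat (word_perm_repr u) (word_perm_repr v)).
Qed.

Lemma faddC : commutative fadd.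
Proof.
move=> g h; apply: word_permP.
exact: (permEl (perm_catC (letters (repr g)) (letters (repr h)))).
Qed.

Lemma faddA : associative fadd.
Proof.
move=> g h k; apply: word_permP.
have lettersE u v : letters (word_cat u v) = letters u ++ letters v by [].
have catP u v : perm_eq (letters (repr (\pi_formal_sum (word_cat u v))))
    (letters u ++ letters v) by exact: word_perm_repr.
rewrite /word_perm !lettersE (perm_trans (_ : perm_eq _
  (letters (repr g) ++ letters (repr h) ++ letters (repr k)))) //.
  by rewrite perm_cat2l catP.
by rewrite perm_sym catA perm_cat2r catP.
Qed.

HB.instance Definition _ := Algebra.isAddSemigroup.Build formal_sum faddC faddA.

Variables (T : addSemigroupType) (f : X -> T).

(* The starting value of the iteration is the first term, so that             *)
(* the sum of the word (x, [:: y1, .., yn]) is f y1 + (.. + (f yn + f x)).    *)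
Definition word_sum (w : X * seq X) : T := \big[+%R/f w.1]_(y <- w.2) f y.

Definition fsum (g : formal_sum) : T := word_sum (repr g).

Lemma word_sum_perm (u v : X * seq X) :
  word_perm u v -> word_sum u = word_sum v.
Proof.
have wsE (w : X * seq X) : Some (word_sum w) =
    \big[oAC (@Algebra.addrA T) (@Algebra.addrC T)/None]_(y <- letters w)
      Some (f y).
  rewrite /letters big_cons /word_sum.
  rewrite (some_big_AC_mk_monoid (@Algebra.addrA T) (@Algebra.addrC T)).
  exact: Monoid.mulmC.
by move=> uv; apply: Some_inj; rewrite !wsE; apply: perm_big.
Qed.

Lemma fsum_pi (w : X * seq X) : fsum (\pi_formal_sum w) = word_sum w.
Proof. exact/word_sum_perm/word_perm_repr. Qed.

Lemma fsum_gen (x : X) : fsum (fgen x) = f x.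
Proof. by rewrite fsum_pi /word_sum big_nil. Qed.

Lemma word_sum_cons (x y : X) (s : seq X) :
  word_sum (x, y :: s) = f y + word_sum (x, s).
Proof. by rewrite /word_sum big_cons. Qed.

Lemma fsumD (g h : formal_sum) : fsum (g + h) = fsum g + fsum h.
Proof.
rewrite -[g]reprK -[h]reprK [_ + _]faddE !fsum_pi.
case: (repr g) (repr h) => x s [y t].
rewrite (@word_sum_perm _ (y, x :: s ++ t)); last first.
  exact: (permEl (perm_catCA (x :: s) [:: y] t)).
rewrite word_sum_cons; elim: s => [|z s IHs] /=.
  by rewrite {2}/word_sum big_nil.
by rewrite !word_sum_cons Algebra.addrCA IHs Algebra.addrA.
Qed.

End FormalSums.

Lemma fsum_ind (X : choiceType) (P : formal_sum X -> Prop) :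
    (forall x, P (fgen x)) -> (forall g h, P g -> P h -> P (g + h)) ->
  forall g, P g.
Proof.
move=> P1 PD g; rewrite -[g]reprK; case: (repr g) => x s.
elim: s => [|y s IHs]; first exact: P1.
have -> : \pi_(formal_sum X) (x, y :: s) = fgen y + \pi_(formal_sum X) (x, s).
  rewrite [_ + _]faddE; apply: word_permP.
  exact: (permEl (perm_catCA [:: x] [:: y] s)).
by apply: PD.
Qed.

Section RightOperatorSemiring.
Variables (G : addSemigroupType) (S : gammaSemiringType G).

(* a . sum_i (al_i, x_i) = sum_i a al_i x_i *)
Definition fsact (a : S) (g : formal_sum (G * S)%type) : S :=
  fsum (fun p => a ·[p.1] p.2) g.

Definition op_equiv (g h : formal_sum (G * S)%type) : bool :=
  `[< forall a, fsact a g = fsact a h >].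

Lemma op_equivP g h : reflect (forall a, fsact a g = fsact a h) (op_equiv g h).
Proof. exact: asboolP. Qed.

Lemma op_equiv_refl : reflexive op_equiv.
Proof. by move=> g; apply/op_equivP. Qed.

Lemma op_equiv_sym : symmetric op_equiv.
Proof.
by move=> g h; apply/op_equivP/op_equivP => gh a; rewrite gh.
Qed.

Lemma op_equiv_trans : transitive op_equiv.
Proof.
by move=> g h k /op_equivP hg /op_equivP gk; apply/op_equivP => a; rewrite hg.
Qed.

Canonical op_equiv_equiv :=
  EquivRel op_equiv op_equiv_refl op_equiv_sym op_equiv_trans.

Definition right_op := {eq_quot op_equiv}.
HB.instance Definition _ := Choice.on right_op.
HB.instance Definition _ := EqQuotient.on right_op.

(* sum_(i, j) (al_i, x_i be_j y_j) *)
Definition fmul (g h : formal_sum (G * S)%type) : formal_sum (G * S)%type :=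
  fsum (fun p => fsum (fun q => fgen (p.1, p.2 ·[q.1] q.2)) h) g.

Definition radd (p q : right_op) : right_op := \pi_right_op (repr p + repr q).
Definition rmul (p q : right_op) : right_op :=
  \pi_right_op (fmul (repr p) (repr q)).

(* a . sum_i [al_i, x_i] = sum_i a al_i x_i *)
Definition ract (a : S) (p : right_op) : S := fsact a (repr p).

Lemma fsactDr a g h : fsact a (g + h) = fsact a g + fsact a h.
Proof. exact: fsumD. Qed.

Lemma fsactDl a b g : fsact (a + b) g = fsact a g + fsact b g.
Proof.
elim/fsum_ind: g => [x|g h IHg IHh]; first by rewrite /fsact !fsum_gen tmulDl.
by rewrite !fsactDr IHg IHh Algebra.addrACA.
Qed.

Lemma fsactM a g h : fsact a (fmul g h) = fsact (fsact a g) h.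
Proof.
elim/fsum_ind: g => [x|g g' IHg IHg']; last first.
  by rewrite /fmul fsumD !fsactDr fsactDl -IHg -IHg'.
rewrite /fmul fsum_gen; elim/fsum_ind: h => [y|h h' IHh IHh'].
  by rewrite /fsact !fsum_gen /= tmulA.
by rewrite fsumD !fsactDr IHh IHh'.
Qed.

Lemma ract_pi a g : ract a (\pi_right_op g) = fsact a g.
Proof.
have : op_equiv (repr (\pi_right_op g)) g by apply/eqmodP; rewrite reprK.
by move/op_equivP; apply.
Qed.

Lemma right_op_ext (p q : right_op) : (forall a, ract a p = ract a q) -> p = q.
Proof.
by move=> pq; rewrite -[p]reprK -[q]reprK; apply/eqmodP/op_equivP.
Qed.

Lemma ract_radd a p q : ract a (radd p q) = ract a p + ract a q.
Proof. by rewrite ract_pi fsactDr. Qed.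

Lemma ract_rmul a p q : ract a (rmul p q) = ract (ract a p) q.
Proof. by rewrite ract_pi fsactM. Qed.

Lemma radd_pi g h : radd (\pi_right_op g) (\pi_right_op h) =
  \pi_right_op (g + h).
Proof.
by apply: right_op_ext => a; rewrite ract_radd !ract_pi fsactDr.
Qed.

Lemma rmul_pi g h : rmul (\pi_right_op g) (\pi_right_op h) =
  \pi_right_op (fmul g h).
Proof.
by apply: right_op_ext => a; rewrite ract_rmul !ract_pi fsactM.
Qed.

Lemma raddC : commutative radd.
Proof. by move=> p q; rewrite /radd Algebra.addrC. Qed.

Lemma raddA : associative radd.
Proof.
by move=> p q r; apply: right_op_ext => a; rewrite !ract_radd Algebra.addrA.
Qed.

Lemma rmulA : associative rmul.
Proof. by move=> p q r; apply: right_op_ext => a; rewrite !ract_rmul. Qed.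

HB.instance Definition _ := Algebra.isAddSemigroup.Build right_op raddC raddA.
HB.instance Definition _ := hasMul.Build right_op rmul.
HB.instance Definition _ := Magma_isSemigroup.Build right_op rmulA.

Lemma ractDl a b (p : right_op) : ract (a + b) p = ract a p + ract b p.
Proof. exact: fsactDl. Qed.

Lemma ractDr a (p q : right_op) : ract a (p + q) = ract a p + ract a q.
Proof. exact: ract_radd. Qed.

Lemma ractM a (p q : right_op) : ract a (p * q)%g = ract (ract a p) q.
Proof. exact: ract_rmul. Qed.

Lemma right_op_mulDl (p q r : right_op) :
  ((p + q)%R * r)%g = (p * r)%g + (q * r)%g.
Proof.
by apply: right_op_ext => a; rewrite ractDr !ractM ractDr ractDl.
Qed.

Lemma right_op_mulDr (p q r : right_op) :
  (p * (q + r)%R)%g = (p * q)%g + (p * r)%g.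
Proof. by apply: right_op_ext => a; rewrite ractDr !ractM ractDr. Qed.

HB.instance Definition _ :=
  isBareSemiring.Build right_op right_op_mulDl right_op_mulDr.

Definition has_right_unity : Prop :=
  exists e : right_op, forall a, ract a e = a.

Definition has_left_unity : Prop :=
  exists e : formal_sum (S * G)%type,
    forall a, fsum (fun p => p.1 ·[p.2] a) e = a.

End RightOperatorSemiring.

Arguments has_right_unity {G} S.
Arguments has_left_unity {G} S.

Definition fuzzy (K : realType) (X : Type) : Type := X -> {i01 K}.

Section FuzzyIdealsGamma.
Variables (K : realType) (G : addSemigroupType) (S : gammaSemiringType G).
Variable mu : fuzzy K S.

Definition gamma_fuzzy_left_ideal : Prop :=
  (forall a b : S, Num.min (mu a)%:num (mu b)%:num <= (mu (a + b))%:num) /\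
  (forall (a : S) (al : G) (b : S), (mu b)%:num <= (mu (a ·[al] b))%:num).

Definition gamma_fuzzy_right_ideal : Prop :=
  (forall a b : S, Num.min (mu a)%:num (mu b)%:num <= (mu (a + b))%:num) /\
  (forall (a : S) (al : G) (b : S), (mu a)%:num <= (mu (a ·[al] b))%:num).

Definition gamma_fuzzy_ideal : Prop :=
  gamma_fuzzy_left_ideal /\ gamma_fuzzy_right_ideal.

End FuzzyIdealsGamma.

Section FuzzyIdealsSemiring.
Variables (K : realType) (R : bareSemiringType).
Variable mu : fuzzy K R.

Definition fuzzy_left_ideal : Prop :=
  (forall p q : R, Num.min (mu p)%:num (mu q)%:num <= (mu (p + q))%:num) /\
  (forall p q : R, (mu q)%:num <= (mu (p * q)%g)%:num).

Definition fuzzy_right_ideal : Prop :=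
  (forall p q : R, Num.min (mu p)%:num (mu q)%:num <= (mu (p + q))%:num) /\
  (forall p q : R, (mu p)%:num <= (mu (p * q)%g)%:num).

Definition fuzzy_ideal : Prop := fuzzy_left_ideal /\ fuzzy_right_ideal.

End FuzzyIdealsSemiring.

Section StarPrime.
Variables (K : realType) (G : addSemigroupType) (S : gammaSemiringType G).
Variable sigma : fuzzy K S.

Definition star_val (p : right_op S) : K :=
  inf (range (fun a : S => (sigma (ract a p))%:num)).

Lemma star_val_ge0 p : 0 <= star_val p.
Proof.
have [a0] := @carrier_inhabited G S.
apply: lb_le_inf; first by exists (sigma (ract a0 p))%:num; exists a0.
by move=> _ [a _ <-].
Qed.

Lemma star_val_le1 p : star_val p <= 1.
Proof.
have [a0] := @carrier_inhabited G S.
apply: (@le_trans _ _ (sigma (ract a0 p))%:num) => //.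
apply: ge_inf; last by exists a0.
by exists 0 => _ [a _ <-].
Qed.

Definition star_prime : fuzzy K (right_op S) :=
  fun p => Itv01 (star_val_ge0 p) (star_val_le1 p).

Lemma star_primeE p :
  (star_prime p)%:num = inf (range (fun a : S => (sigma (ract a p))%:num)).
Proof. by []. Qed.

End StarPrime.

(* Main.v *)
Require Import Defs.
From mathcomp Require Import all_boot all_order all_algebra.
From mathcomp Require Import interval_inference all_classical all_reals.

Import Order.TTheory Num.Theory.
Local Open Scope ring_scope.

(** [R] acts on [S] from the right through [ract], with a(p + q) = ap + aq and a(pq) = (ap)q, and
    [star_prime sigma p] is the infimum of [sigma] over the orbit of p under this action. So each
    inequality on [R] reduces to a pointwise one on [S]. Sums follow from additivity of the action.
    For products on the left, the orbit of pq lies in that of q ([star_primeMl]); on the right,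
    acting by q cannot decrease a fuzzy right ideal ([fuzzy_right_ideal_ract]). *)

Section StarPrimeTheory.
Variables (K : realType) (G : addSemigroupType) (S : gammaSemiringType G).
Variable sigma : fuzzy K S.

Lemma star_prime_le (p : right_op S) (a : S) :
  (star_prime sigma p)%:num <= (sigma (ract a p))%:num.
Proof.
rewrite star_primeE; apply: ge_inf; last by exists a.
(* The values of [sigma] lie in [0, 1], so 0 bounds the range below. *)
by exists 0 => _ [b _ <-].
Qed.

Lemma le_star_prime (p : right_op S) (x : K) :
  (forall a, x <= (sigma (ract a p))%:num) -> x <= (star_prime sigma p)%:num.
Proof.
(* A point of [S] makes the range nonempty, as [lb_le_inf] requires. *)
move=> xle; rewrite star_primeE; have [a0] := @carrier_inhabited G S.
apply: lb_le_inf; first by exists (sigma (ract a0 p))%:num; exists a0.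
by move=> _ [a _ <-].
Qed.

Lemma star_primeD :
    (forall a b : S,
      Num.min (sigma a)%:num (sigma b)%:num <= (sigma (a + b))%:num) ->
  forall p q : right_op S,
    Num.min (star_prime sigma p)%:num (star_prime sigma q)%:num
      <= (star_prime sigma (p + q))%:num.
Proof.
move=> sigmaD p q; apply: le_star_prime => a.
rewrite ractDr; apply: le_trans (sigmaD _ _).
by rewrite le_min !ge_min !star_prime_le orbT.
Qed.

(* The values a(pq) = (ap)q are among the values bq. *)
Lemma star_primeMl (p q : right_op S) :
  (star_prime sigma q)%:num <= (star_prime sigma (p * q)%g)%:num.
Proof. by apply: le_star_prime => a; rewrite ractM star_prime_le. Qed.

(** Every term of ap has a as its left factor, so the product law bounds each term and the sum law
    bounds their sum: induction on a formal sum representing p. *)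
Lemma fuzzy_right_ideal_ract (a : S) (p : right_op S) :
  gamma_fuzzy_right_ideal sigma ->
  (sigma a)%:num <= (sigma (ract a p))%:num.
Proof.
move=> [sigmaD sigmaM]; rewrite /ract.
elim/fsum_ind: (repr p) => [x|g h IHg IHh]; first by rewrite /fsact fsum_gen.
by rewrite fsactDr; apply: le_trans (sigmaD _ _); rewrite le_min IHg IHh.
Qed.

Lemma star_prime_left_ideal :
  gamma_fuzzy_left_ideal sigma -> fuzzy_left_ideal (star_prime sigma).
Proof. by case=> /star_primeD sD _; split=> //; exact: star_primeMl. Qed.

Lemma star_prime_right_ideal :
  gamma_fuzzy_right_ideal sigma -> fuzzy_right_ideal (star_prime sigma).
Proof.
move=> rI; split; first exact: star_primeD rI.1.
move=> p q; apply: le_star_prime => a; rewrite ractM.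
(* The chain passes through the value of [sigma] at ap. *)
exact: le_trans (star_prime_le p a) (fuzzy_right_ideal_ract _ q rI).
Qed.

End StarPrimeTheory.

Theorem proposition3p5 (K : realType) (G : addSemigroupType)
    (S : gammaSemiringType G)
    (left_unity : has_left_unity S) (right_unity : has_right_unity S)
    (sigma : fuzzy K S) :
  ((gamma_fuzzy_left_ideal sigma -> fuzzy_left_ideal (star_prime sigma)) /\
   (gamma_fuzzy_right_ideal sigma -> fuzzy_right_ideal (star_prime sigma))) /\
  (gamma_fuzzy_ideal sigma -> fuzzy_ideal (star_prime sigma)).
Proof.
have lI := @star_prime_left_ideal K G S sigma.
have rI := @star_prime_right_ideal K G S sigma.
by split=> // -[/lI ? /rI ?].
Qed.
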